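(* Let $x,y$ be indeterminates and let $(M_{n,k})$ be defined by $M_{0,0}=1$, $M_{0,k}=0$ ($k>0$), and for $n\ge1$: $M_{n,0}=xM_{n-1,0}$ and $M_{n,k}=M_{n-1,k-1}+yM_{n-1,k}$ ($k\ge1$); so $M_{n,k}=0$ for $k>n$. Then for all integers $m,n\ge0$, $$\sum_{k=0}^{\min\{m,n\}}y^{2k}\det\begin{pmatrix}M_{n,k}&M_{n,k+1}\\ M_{m,k}&M_{m,k+1}\end{pmatrix}=\sum_{k=1}^{\max\{m,n\}}\left(\binom{m+n-k}{n}-\binom{m+n-k}{m}\right)x^{k-1}y^{m+n-k}.$$
   Context: Explicitly $M_{n,k}=\sum_{j=0}^{n-k}\binom{j+k-1}{j}x^{n-k-j}y^j$ for $n\ge k\ge 0$. Binomial coefficients $\binom{a}{b}$ with $b>a\ge0$ are $0$. *)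

(* Defs.v *)
From HB Require Import structures.
From mathcomp Require Import all_boot all_order all_algebra.
From mathcomp Require Import mpoly.

Set Implicit Arguments.
Unset Strict Implicit.
Unset Printing Implicit Defensive.

Import GRing.Theory.
Local Open Scope ring_scope.

Fixpoint Mnk (A : comNzRingType) (x y : A) (n k : nat) : A :=
  match n, k with
  | 0, 0 => 1
  | 0, _.+1 => 0
  | n'.+1, 0 => x * Mnk x y n' 0
  | n'.+1, k'.+1 => Mnk x y n' k' + y * Mnk x y n' k'.+1
  end.

Definition mx22 (A : comNzRingType) (a b c d : A) : 'M[A]_2 :=
  \matrix_(i < 2, j < 2)
    if i == ord0 then (if j == ord0 then a else b)
    else (if j == ord0 then c else d).

(* Main.v *)
Require Import Defs.
From HB Require Import structures.
From mathcomp Require Import all_boot all_order all_algebra.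
From mathcomp Require Import mpoly.
From mathcomp Require Import zify ring.

Set Implicit Arguments.
Unset Strict Implicit.
Unset Printing Implicit Defensive.

Import GRing.Theory.
Local Open Scope ring_scope.

(** Both sides, viewed as functions of [(m, n)], satisfy
    [F (m+1) (n+1) = y F m (n+1) + y F (m+1) n]: on the right this is Pascal's
    rule, and on the left the defect telescopes as the sum of [t_k - t_(k+1)]
    with [t_k = y^(2k) (M_(n+1,k) M_(m,k) - M_(n,k) M_(m+1,k))], where
    [t_0 = 0] and [t_k = 0] for large [k].  When [m = 0] or [n = 0] both sides
    are, up to sign, the complete homogeneous polynomial [M_(_,1)]. *)

Section Recurrence.
Variables (A : comNzRingType) (x y : A).
Local Notation M := (Mnk x y).

Lemma det_mx22 (a b c d : A) : \det (mx22 a b c d) = a * d - b * c.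
Proof.
rewrite (expand_det_row _ ord0) !big_ord_recl big_ord0 addr0 /cofactor.
by rewrite !det_mx11 !mxE /= expr0 expr1; ring.
Qed.

Lemma Mnk_gt n k : (n < k)%N -> M n k = 0.
Proof.
elim: n k => [|n IHn] [|k] //= ltnk.
by rewrite !IHn ?mulr0 ?addr0 // ltnW.
Qed.

Lemma Mnk0 n : M n 0 = x ^+ n.
Proof. by elim: n => [|n IHn] //=; rewrite IHn exprS. Qed.

Lemma Mnk1 n : M n 1 = \sum_(1 <= k < n.+1) x ^+ (k - 1) * y ^+ (n - k).
Proof.
elim: n => [|n IHn]; first by rewrite big_geq.
rewrite /= Mnk0 IHn [RHS]big_nat_recr //= subn1 subnn mulr1 addrC.
congr (_ + _); rewrite big_distrr; apply: eq_big_nat => k /andP[_ lekn].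
by rewrite subSn // exprS mulrCA.
Qed.

(** The free bound [N] lets the three sums in [minor_sumSS] share one range. *)
Definition minor_sum N m n : A :=
  \sum_(0 <= k < N) y ^+ (2 * k) * (M n k * M m k.+1 - M n k.+1 * M m k).

(** Past the smaller of [m] and [n], one row of the minor is zero, which kills both products. *)
Lemma minor_sum_cutoff N m n :
  (minn m n < N)%N -> minor_sum N m n = minor_sum (minn m n).+1 m n.
Proof.
move=> ltN; rewrite /minor_sum (big_cat_nat (leq0n _) ltN) /=.
rewrite [X in _ + X]big1_seq ?addr0 // => k /andP[_].
rewrite mem_index_iota gtn_min => /andP[/orP[lt|lt] _].
  by rewrite !(@Mnk_gt m) ?mulr0 ?subr0 ?mulr0 // ltnW.
by rewrite !(@Mnk_gt n) ?mul0r ?subr0 ?mulr0 // ltnW.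
Qed.

Lemma minor_sumC N m n : minor_sum N n m = - minor_sum N m n.
Proof. by rewrite /minor_sum -sumrN; apply: eq_bigr => k _; ring. Qed.

Lemma minor_sum0 N n : (0 < N)%N -> minor_sum N n 0 = M n 1.
Proof.
move=> N0; rewrite minor_sum_cutoff minn0 // /minor_sum big_nat1 /=.
by rewrite mul0r subr0 !mul1r.
Qed.

Lemma minor_sumSS N m n : (m.+1 < N)%N -> (n.+1 < N)%N ->
  minor_sum N m.+1 n.+1 = y * minor_sum N m n.+1 + y * minor_sum N m.+1 n.
Proof.
move=> ltmN ltnN; apply/eqP; rewrite -subr_eq0; apply/eqP.
(* The sign is opposite to that of [t_k] above because [telescope_sumr] sums [t k.+1 - t k]; the
   bounds on [N] give [t N = 0]. *)
pose t k := - (y ^+ (2 * k) * (M n.+1 k * M m k - M n k * M m.+1 k)).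
transitivity (\sum_(0 <= k < N) (t k.+1 - t k)); last first.
  rewrite telescope_sumr // /t !(@Mnk_gt _ N) //; try exact: ltnW.
  by rewrite /=; ring.
rewrite /minor_sum !big_distrr -big_split -sumrB /=.
apply: eq_bigr => k _; rewrite /t mulnS exprD.
(* Column 0 obeys its own clause of the recursion for [Mnk]. *)
by case: k => [|k] /=; ring.
Qed.

Definition binom_sum N m n : A :=
  \sum_(1 <= k < N.+1)
     ('C(m + n - k, n)%:R - 'C(m + n - k, m)%:R) * x ^+ (k - 1) * y ^+ (m + n - k).

(** For [maxn m n < k <= m + n], the upper index [m + n - k] is below both [m] and [n]. *)
Lemma binom_sum_cutoff m n :
  binom_sum (m + n) m n = binom_sum (maxn m n) m n.
Proof.
have le : (maxn m n <= m + n)%N by lia.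
rewrite /binom_sum (@big_cat_nat _ _ _ (maxn m n).+1) //=.
rewrite [X in _ + X]big1_seq ?addr0 // => k /andP[_].
rewrite mem_index_iota => /andP[lk ku].
by rewrite !bin_small ?subrr ?mul0r //; lia.
Qed.

Lemma binom_sumC N m n : binom_sum N n m = - binom_sum N m n.
Proof.
rewrite /binom_sum -sumrN; apply: eq_bigr => k _.
by rewrite addnC -!mulNr opprB.
Qed.

Lemma binom_sum0 n : binom_sum n n 0 = M n 1.
Proof.
rewrite Mnk1; apply: eq_big_nat => k /andP[k1 kn].
by rewrite addn0 bin0 bin_small ?subr0 ?mul1r //; lia.
Qed.

(** With bound [m + n], both sums on the right have the same range; the four binomials produced by
    Pascal's rule regroup crosswise. *)
Lemma binom_sumSS m n :
  binom_sum (m.+1 + n.+1) m.+1 n.+1 =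
  y * binom_sum (m + n.+1) m n.+1 + y * binom_sum (m.+1 + n) m.+1 n.
Proof.
(* The left range has one extra term, whose binomials have upper index 0 and positive lower
   index. *)
rewrite {1}/binom_sum addSn big_nat_recr //= subnn !bin0n subrr !mul0r addr0.
rewrite /binom_sum !addSnnS !big_distrr -big_split /=.
apply: eq_big_nat => k /andP[_ lek].
by rewrite subSn // !binS !natrD exprS; ring.
Qed.

Lemma minor_sumE N m n :
  (m + n < N)%N -> minor_sum N m n = binom_sum (m + n) m n.
Proof.
elim: m n => [|m IHm] n ltN.
  (* Antisymmetry reduces [m = 0] to the boundary where the second index is 0. *)
  by rewrite minor_sumC binom_sumC minor_sum0 ?binom_sum0 //; lia.
elim: n ltN => [|n IHn] ltN; first by rewrite addn0 minor_sum0 ?binom_sum0 //; lia.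
by rewrite minor_sumSS ?binom_sumSS ?IHm ?IHn //; lia.
Qed.

End Recurrence.

Theorem theorem4p2 (R : comNzRingType) (m n : nat) :
  let x : {mpoly R[2]} := 'X_ord0 in
  let y : {mpoly R[2]} := 'X_ord_max in
  \sum_(0 <= k < (minn m n).+1)
     y ^+ (2 * k) * \det (mx22 (Mnk x y n k) (Mnk x y n k.+1)
                               (Mnk x y m k) (Mnk x y m k.+1))
  = \sum_(1 <= k < (maxn m n).+1)
     ('C(m + n - k, n)%:R - 'C(m + n - k, m)%:R) * x ^+ (k - 1) * y ^+ (m + n - k).
Proof.
move=> x y; transitivity (minor_sum x y (minn m n).+1 m n).
  by apply: eq_bigr => k _; rewrite det_mx22.
(* Padding with zero terms reaches a bound large enough for [minor_sumE]. *)
rewrite -(@minor_sum_cutoff _ _ _ (m + n).+1); last by lia.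
by rewrite minor_sumE // binom_sum_cutoff.
Qed.
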